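(* Let $n>0$ be an integer with binary expansion $n=\sum_{i=0}^{k}n_i2^i$, $n_i\in\{0,1\}$, $k=\lfloor\log_2(n)\rfloor$. The number $\delta(n)$ of $D$-nodes in a divide-and-conquer tree with $n$ leaf nodes satisfies $$\delta(n)=\sum_{i=0}^{k-1}2^i\cdot n_i\cdot\Bigl(k-i-2\sum_{j=i}^k n_j+4\Bigr),$$ or alternatively $$\delta(n)=\sum_{i=0}^{k-1}2^i\cdot n_i\cdot\Bigl(k-i-2\,s_1\bigl(\lfloor n/2^i\rfloor\bigr)+4\Bigr).$$
   Context: The Hamming weight $s_1(m)$ is the number of $1$s in the binary expansion of $m$. A full binary tree is a rooted binary tree in which every interior node has exactly two children. An interior node of a full binary tree is an $S$-node if its two subtrees have the same number of leaves, and a $D$-node if its two subtrees have different numbers of leaves. A divide-and-conquer tree is a full binary tree in which the numbers of leaf descendants of the left and right children of any interior node differ by at most $1$ (a child that is a leaf counts as having one leaf). For each $n\ge 1$ there is exactly one such tree with $n$ leaves up to tree isomorphism; $\delta(n)$ denotes its number of $D$-nodes. Empty sums are $0$. *)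

(* Defs.v *)
From mathcomp Require Import all_boot all_order all_algebra zify.
Set Implicit Arguments.
Unset Strict Implicit.
Unset Printing Implicit Defensive.

Inductive full_bintree : Type :=
| Leaf
| Node of full_bintree & full_bintree.

Fixpoint leaves (t : full_bintree) : nat :=
  if t is Node l r then leaves l + leaves r else 1.

Fixpoint D_nodes (t : full_bintree) : nat :=
  if t is Node l r then (leaves l != leaves r) + (D_nodes l + D_nodes r) else 0.

Fixpoint is_dc (t : full_bintree) : bool :=
  if t is Node l r then
    [&& leaves l <= (leaves r).+1, leaves r <= (leaves l).+1, is_dc l & is_dc r]
  else true.

Definition bit (m i : nat) : bool := odd (m %/ 2 ^ i).

(* The expansion of 0 is the single digit 0, since trunc_log 2 0 = 0. *)
Definition s1 (m : nat) : nat := \sum_(0 <= i < (trunc_log 2 m).+1) bit m i.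

(* Trees up to exchanging the children of interior nodes. *)
Fixpoint tree_iso (t u : full_bintree) : bool :=
  match t, u with
  | Leaf, Leaf => true
  | Node l r, Node l' r' =>
      (tree_iso l l' && tree_iso r r') || (tree_iso l r' && tree_iso r l')
  | _, _ => false
  end.

Lemma leaves_gt0 t : 0 < leaves t.
Proof. by elim: t => //= l IHl r _; rewrite addn_gt0 IHl. Qed.

Lemma leaves_Node l r : leaves (Node l r) = 1 -> False.
Proof. by have := leaves_gt0 l; have := leaves_gt0 r; rewrite /=; lia. Qed.

Lemma dc_exists n : 0 < n -> exists2 t, is_dc t & leaves t = n.
Proof.
elim/ltn_ind: n => -[|[|n]] // IHn _; first by exists Leaf.
have [||l dcl nl] := IHn (uphalf n.+2); [lia | lia |].
have [||r dcr nr] := IHn n.+2./2; [lia | lia |].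
by exists (Node l r); rewrite /= ?dcl ?dcr nl nr ?andbT; lia.
Qed.

Lemma dc_unique t u : is_dc t -> is_dc u -> leaves t = leaves u -> tree_iso t u.
Proof.
elim: t u => [|l IHl r IHr] [|l' r'] //.
- by move=> _ _ /esym/leaves_Node.
- by move=> _ _ /leaves_Node.
move=> /= /and4P[lr rl dl dr] /and4P[lr' rl' dl' dr'] E.
have [[e1 e2]|[e1 e2]] : (leaves l = leaves l' /\ leaves r = leaves r')
    \/ (leaves l = leaves r' /\ leaves r = leaves l') by lia.
- by rewrite (IHl l' dl dl' e1) (IHr r' dr dr' e2).
- by rewrite (IHl r' dl dr' e1) (IHr l' dr dl' e2) orbT.
Qed.

Lemma bit_expansion n :
  n = \sum_(0 <= i < (trunc_log 2 n).+1) bit n i * 2 ^ i.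
Proof.
have H k : n = \sum_(0 <= i < k) bit n i * 2 ^ i + n %/ 2 ^ k * 2 ^ k.
  elim: k => [|k IHk]; first by rewrite big_nil divn1 muln1.
  rewrite big_nat_recr //= {1}IHk -addnA; congr (_ + _).
  rewrite expnSr divnMA /bit divn2 -{1}(odd_double_half (n %/ 2 ^ k)).
  by rewrite mulnDl; congr (_ + _); rewrite -muln2 -mulnA (mulnC 2).
by rewrite {1}(H (trunc_log 2 n).+1) divn_small ?addn0 // trunc_log_ltn.
Qed.

(* Main.v *)
Require Import Defs.
From mathcomp Require Import all_boot all_order all_algebra.
From mathcomp Require Import zify ring.
Import GRing.Theory.
Local Open Scope ring_scope.

(** At depth [d] a divide-and-conquer tree with [n] leaves, where
    [2 ^ k <= n < 2 ^ k.+1] and [d < k], has [2 ^ d] interior nodes, each with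
    [n %/ 2 ^ d] or one more leaves; exactly [n %% 2 ^ d] of them have one
    more. A node is a D-node iff its number of leaves is odd and greater than
    1, so depth [d] contributes [2 ^ d - n %% 2 ^ d] D-nodes when the digit
    [n_d] is 1, and [n %% 2 ^ d] when it is 0. In both cases this is the
    distance from [n] to the nearest multiple of [2 ^ d.+1], and the number of
    D-nodes is the sum of these distances over [d < k] ([D_nodes_dc]).

    Counting along depths is replaced in the proof by a recurrence: the
    distance to the multiples of [2 * M] is a triangle wave in [n], hence for
    even [M] it splits as the sum of the distances of [n./2] and [uphalf n], the
    leaf counts of the two subtrees, to the multiples of [M]
    ([dist_mult_halve]).

    In terms of digits, depth [d] contributes
    [n_d 2 ^ d + (1 - 2 n_d) \sum_(i < d) n_i 2 ^ i]. Collecting the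
    coefficient of [n_i 2 ^ i] over all depths gives
    [1 + \sum_(i < d < k) (1 - 2 n_d)], and [n_i = n_k = 1] turns it into
    [k - i - 2 \sum_(i <= j <= k) n_j + 4] ([sum_dist_digits]). *)

(** * Distances to multiples and the count of D-nodes *)

Definition dist_mult (M n : nat) : nat := minn (n %% M) (M - n %% M).

(** The triangle wave of period [4 * h] is affine between consecutive multiples
    of [2 * h], so its value at [n] is the sum of two half-scale values
    at [n./2] and [uphalf n], which never lie strictly on both sides of a
    multiple of [h]. *)
Lemma dist_mult_halve (h n : nat) : (0 < h)%N ->
  dist_mult (4 * h) n =
    (dist_mult (2 * h) n./2 + dist_mult (2 * h) (uphalf n))%N.
Proof.
move=> h0; rewrite /dist_mult.
have modE (M q r : nat) : (r < M)%N -> ((q * M + r) %% M = r)%N.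
  by move=> ltrM; rewrite modnMDl modn_small.
have [q [r [rM ->]]] :
    exists q r : nat, (r < 4 * h)%N /\ n = (q * (4 * h) + r)%N.
  exists (n %/ (4 * h))%N, (n %% (4 * h))%N; split; last exact: divn_eq.
  by rewrite ltn_mod muln_gt0.
have -> : (q * (4 * h) + r)./2 = (q * (2 * h) + r./2)%N by lia.
have -> : uphalf (q * (4 * h) + r) = (q * (2 * h) + uphalf r)%N by lia.
rewrite (modE _ q r) // (modE _ q r./2); last by lia.
(* Rounding up reaches the next multiple of [2 * h] only for [r = 4 * h - 1]. *)
have [ltr|ler] := ltnP (uphalf r) (2 * h); first by rewrite modE; lia.
have -> : (q * (2 * h) + uphalf r = q.+1 * (2 * h) + 0)%N by lia.
by rewrite modE; lia.
Qed.

Lemma leaves1_leaf t : leaves t = 1%N -> t = Leaf.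
Proof. by case: t => // l r /leaves_Node. Qed.

(** The range of [leaves t] includes [2 ^ k.+1], so that it passes to both
    subtrees: the upper half of [2 ^ k.+1 - 1] is [2 ^ k]. *)
Lemma D_nodes_dc (k : nat) (t : full_bintree) :
    is_dc t -> (2 ^ k <= leaves t <= 2 ^ k.+1)%N ->
  D_nodes t = (\sum_(0 <= d < k) dist_mult (2 ^ d.+1) (leaves t))%N.
Proof.
elim: k t => [|k IHk] [|l r] /=.
- by rewrite big_nil.
- move=> _ /andP[_ le2]; rewrite big_nil.
  have l0 := leaves_gt0 l; have r0 := leaves_gt0 r.
  have l1 : leaves l = 1%N by lia.
  have r1 : leaves r = 1%N by lia.
  by rewrite l1 r1 (leaves1_leaf _ l1) (leaves1_leaf _ r1).
- by move=> _; rewrite leqNgt expnS; have := expn_gt0 2 k; lia.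
case/and4P=> lr rl dcl dcr; rewrite !expnS => /andP[lo hi].
rewrite (IHk l dcl) ?(IHk r dcr); try by rewrite expnS; lia.
rewrite big_nat_recl // -big_split /=; congr (_ + _)%N.
  rewrite /dist_mult expn1; lia.
apply: eq_bigr => d _.
have -> : (2 ^ d.+2 = 4 * 2 ^ d)%N by rewrite !expnS mulnA.
rewrite dist_mult_halve ?expn_gt0 // expnS.
have [[-> ->]|[-> ->]] : ((leaves l + leaves r)./2 = leaves l /\
    uphalf (leaves l + leaves r) = leaves r) \/
    ((leaves l + leaves r)./2 = leaves r /\
    uphalf (leaves l + leaves r) = leaves l) by lia.
  by [].
by rewrite addnC.
Qed.

(** * Binary digits *)

Definition binval (b : nat -> bool) (m : nat) : nat :=
  (\sum_(0 <= i < m) b i * 2 ^ i)%N.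

Lemma binvalS b m : binval b m.+1 = (binval b m + b m * 2 ^ m)%N.
Proof. by rewrite /binval big_nat_recr. Qed.

Lemma ltn_binval b m : (binval b m < 2 ^ m)%N.
Proof.
elim: m => [|m IHm]; first by rewrite /binval big_nil.
by rewrite binvalS expnS; case: (b m); lia.
Qed.

Lemma binval_split b i m :
  binval b (i + m) = (binval (fun j => b (i + j)%N) m * 2 ^ i + binval b i)%N.
Proof.
elim: m => [|m IHm]; first by rewrite addn0 {2}/binval big_nil.
by rewrite addnS !binvalS IHm expnD; lia.
Qed.

Lemma binval_div b i m :
  (binval b (i + m) %/ 2 ^ i = binval (fun j => b (i + j)) m)%N.
Proof.
by rewrite binval_split divnMDl ?expn_gt0 // divn_small ?addn0 // ltn_binval.
Qed.

Lemma bit_binval b i m : (i < m)%N -> bit (binval b m) i = b i.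
Proof.
move=> ltim; rewrite /bit -(subnKC (ltnW ltim)) binval_div.
rewrite -(subnK (_ : 0 < m - i)%N) ?subn_gt0 // addnC binval_split expn1.
by rewrite oddD oddM andbF /binval big_nat1 addn0 muln1 oddb.
Qed.

Lemma s1_binval (b : nat -> bool) m : b m ->
  s1 (binval b m.+1) = (\sum_(0 <= i < m.+1) b i)%N.
Proof.
move=> bm; rewrite /s1 (@trunc_log_eq 2 m) //.
  by apply: eq_big_nat => i /andP[_ ltim]; rewrite bit_binval.
by rewrite ltn_binval binvalS bm mul1n leq_addl.
Qed.

Lemma s1_binval_div (b : nat -> bool) i k : b k -> (i <= k)%N ->
  s1 (binval b k.+1 %/ 2 ^ i)%N = (\sum_(i <= j < k.+1) b j)%N.
Proof.
move=> bk leik; rewrite -{1}(subnKC leik) -addnS binval_div.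
rewrite s1_binval ?subnKC // -[in RHS](add0n i) big_addn subSn //.
by apply: eq_bigr => j _; rewrite addnC.
Qed.

(** The digits above [b d] only add a multiple of [2 ^ d.+1], and
    [2 ^ d] separates the two branches of the minimum. *)
Lemma dist_mult_binval b d m : (d < m)%N ->
  (dist_mult (2 ^ d.+1) (binval b m))%:Z =
    (b d)%:Z * (2 ^ d)%N%:Z + (1 - 2 * (b d)%:Z) * (binval b d)%:Z.
Proof.
move=> ltdm; rewrite /dist_mult -(subnKC ltdm) binval_split modnMDl.
rewrite modn_small ?ltn_binval // binvalS expnS.
by have := ltn_binval b d; case: (b d); lia.
Qed.

(** Both sides regroup the double sum of [b i * 2 ^ i] over [i <= d < k], by
    depth [d] on the left and by digit [i] on the right. Passing from [k] to
    [k.+1] adds [1 - 2 * b k] to the coefficient of every earlier digit and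
    introduces the digit [b k] with coefficient [3 - 2 * b k], which acts as 1
    because [b k] is idempotent. *)
Lemma sum_dist_digits (b : nat -> bool) k :
  \sum_(0 <= d < k) ((b d)%:Z * (2 ^ d)%N%:Z
      + (1 - 2 * (b d)%:Z) * (binval b d)%:Z) =
  \sum_(0 <= i < k) (2 ^ i)%N%:Z * (b i)%:Z
      * (k%:Z - i%:Z - 2 * (\sum_(i <= j < k) b j)%N%:Z + 2).
Proof.
elim: k => [|k IHk]; first by rewrite !big_nil.
rewrite !big_nat_recr //= IHk (@big_geq _ _ _ k k) // add0n.
rewrite [in RHS](eq_big_nat _ _ (F2 := fun i => (2 ^ i)%N%:Z * (b i)%:Z
    * (k%:Z - i%:Z - 2 * (\sum_(i <= j < k) b j)%N%:Z + 2)
    + (1 - 2 * (b k)%:Z) * (b i * 2 ^ i)%N%:Z)); last first.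
  move=> i /andP[_ ltik]; rewrite big_nat_recr ?(ltnW ltik) //=.
  by rewrite PoszM PoszD intS; ring.
rewrite big_split /= -mulr_sumr -addrA; congr (_ + _).
have -> : \sum_(0 <= i < k) (b i * 2 ^ i)%N%:Z = (binval b k)%:Z.
  by rewrite /binval (big_morph Posz PoszD (erefl _)).
by rewrite intS; case: (b k) => /=; ring.
Qed.

Theorem theorem22 (n k : nat) (b : nat -> bool) (hn : (0 < n)%N)
    (hk : k = trunc_log 2 n)
    (hb : n = (\sum_(0 <= i < k.+1) b i * 2 ^ i)%N)
    (t : full_bintree) (ht : is_dc t) (htn : leaves t = n) :
  (D_nodes t)%:Z =
    \sum_(0 <= i < k) (2 ^ i)%N%:Z * (b i)%:Z
      * (k%:Z - i%:Z - 2 * (\sum_(i <= j < k.+1) b j)%N%:Z + 4)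
  /\
  (D_nodes t)%:Z =
    \sum_(0 <= i < k) (2 ^ i)%N%:Z * (b i)%:Z
      * (k%:Z - i%:Z - 2 * (s1 (n %/ 2 ^ i)%N)%:Z + 4).
Proof.
have le_n : (2 ^ k <= n)%N by rewrite hk trunc_logP.
rewrite -/(binval b k.+1) in hb.
have bk : b k.
  move: le_n; rewrite hb binvalS; have := ltn_binval b k.
  by case: (b k); lia.
have lt_n : (n < 2 ^ k.+1)%N by rewrite hb ltn_binval.
set A := RHS; suff DA : (D_nodes t)%:Z = A.
  split=> //; rewrite DA; apply: eq_big_nat => i /andP[_ ltik].
  by rewrite hb s1_binval_div // ltnW.
rewrite (D_nodes_dc k) // htn ?le_n ?(ltnW lt_n) //.
rewrite (big_morph Posz PoszD (erefl _)).
have dE d : (0 <= d < k)%N -> (dist_mult (2 ^ d.+1) n)%:Z =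
    (b d)%:Z * (2 ^ d)%N%:Z + (1 - 2 * (b d)%:Z) * (binval b d)%:Z.
  by case/andP=> _ ltdk; rewrite hb dist_mult_binval // ltnW.
rewrite (eq_big_nat _ _ dE) sum_dist_digits.
apply: eq_big_nat => i /andP[_ ltik].
(* The leading digit [b k = 1] enters the inner sum: 2 becomes 4. *)
by rewrite big_nat_recr ?(ltnW ltik) //= bk PoszD /=; ring.
Qed.
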